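(* Let $X$ be a finite nonempty set of positive integers and let $\mathcal{G}_X$ be the nim sequence of the all-but subtraction game with finite excluded subtraction set $X$. Consider the following (infinite) procedure, which assigns values to nonnegative integers; initially no integer has an assigned value. For $k=0,1,2,\dots$ (stage $k$): let $n$ be the least nonnegative integer with no assigned value, and assign the value $k$ to $n$. Then, for each $x\in X$ considered in increasing order: if $n+x$ has no assigned value and every integer $m<n+x$ that has been assigned the value $k$ satisfies $(n+x)-m\in X$, assign the value $k$ to $n+x$. Then for every $k\geq 0$, the set of integers assigned the value $k$ during stage $k$ is exactly $\{m\geq 0:\mathcal{G}_X(m)=k\}$.
   Context: For a finite set $X$ of positive integers, the all-but subtraction game with finite excluded subtraction set $X$ is the subtraction game with subtraction set $S=\{1,2,3,\dots\}\setminus X$: a position is a heap of $n\geq 0$ counters, and a move removes $s$ counters for some $s\in S$ with $s\leq n$. Its nim sequence is defined by $\mathcal{G}_X(n)=\operatorname{mex}\{\mathcal{G}_X(n-s): s\in S,\ s\leq n\}$ for $n\geq 0$, where $\operatorname{mex}$ of a set of nonnegative integers is the least nonnegative integer not in it. *)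

(* Defs.v *)
From mathcomp Require Import all_boot.
From mathcomp Require Export finmap.

Set Implicit Arguments.
Unset Strict Implicit.
Unset Printing Implicit Defensive.

Local Open Scope fset_scope.
Local Open Scope fmap_scope.
Local Open Scope nat_scope.

Lemma ex_notin_seq (s : seq nat) : exists n, n \notin s.
Proof.
exists (\max_(i <- s) i).+1; apply/negP => sn.
by have := @leq_bigmax_seq _ s xpredT id _ sn isT; rewrite ltnn.
Qed.

Definition mex (s : seq nat) : nat := ex_minn (ex_notin_seq s).

(* Membership in the subtraction set {1, 2, 3, ...} \ X. *)
Definition allbut (X : {fset nat}) : pred nat :=
  fun s => (0 < s) && (s \notin X).

(* The first n terms of the nim sequence of the subtraction game with
   subtraction set S; lemma [nimE] gives the recursion that is meant. *)
Fixpoint nim_prefix (S : pred nat) (n : nat) : seq nat :=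
  if n is n'.+1 then
    let t := nim_prefix S n' in
    rcons t (mex [seq nth 0 t (n' - s) | s <- iota 1 n' & S s])
  else [::].

Definition nim (S : pred nat) (n : nat) : nat := nth 0 (nim_prefix S n.+1) n.

Lemma size_nim_prefix S n : size (nim_prefix S n) = n.
Proof. by elim: n => //= n IHn; rewrite size_rcons IHn. Qed.

Lemma nth_nim_prefix S n i : i < n -> nth 0 (nim_prefix S n) i = nim S i.
Proof.
elim: n => // n IHn; rewrite ltnS leq_eqVlt => /predU1P[-> //|lt_in].
by rewrite /= nth_rcons size_nim_prefix lt_in IHn.
Qed.

Lemma nimE (S : pred nat) (n : nat) :
  nim S n = mex [seq nim S (n - s) | s <- iota 1 n & S s].
Proof.
rewrite {1}/nim /= nth_rcons size_nim_prefix ltnn eqxx.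
congr (mex _); apply/eq_in_map => s; rewrite mem_filter mem_iota add1n ltnS.
move=> /and3P[_ s_gt0 le_sn].
by rewrite nth_nim_prefix // ltn_subrL s_gt0 (leq_trans s_gt0).
Qed.

(* The state of the procedure is the finite partial map sending each integer
   that has an assigned value to that value. *)
Definition state := {fmap nat -> nat}.

Definition least_unassigned (f : state) : nat :=
  ex_minn (ex_notin_seq (domf f)).

Definition try_assign (X : {fset nat}) (k n : nat) (f : state) (x : nat) :
    state :=
  if (n + x \notin domf f) &&
     all (fun m => (f.[? m] == Some k) ==> (n + x - m \in X)) (iota 0 (n + x))
  then f.[n + x <- k] else f.

Definition stage (X : {fset nat}) (k : nat) (f : state) : state :=
  let n := least_unassigned f in
  foldl (try_assign X k n) f.[n <- k] (sort leq X).

(* The state just before stage k. *)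
Fixpoint state_before (X : {fset nat}) (k : nat) : state :=
  if k is k'.+1 then stage X k' (state_before X k') else [fmap].

Definition assigned_during (X : {fset nat}) (k : nat) : {fset nat} :=
  [fset m in domf (state_before X k.+1) |
     (m \notin domf (state_before X k)) &&
     ((state_before X k.+1).[? m] == Some k)].

(* Main.v *)
Require Import Defs.
From mathcomp Require Import all_boot finmap.

Local Open Scope fmap_scope.
Local Open Scope fset_scope.
Local Open Scope nat_scope.

(** Writing G for the nim sequence, a position m has value k exactly when
    G m >= k and every smaller m' of value k satisfies m - m' \in X
    ([nim_allbut_eqP]). Hence, if the integers assigned before stage k are
    exactly those with G < k, the least unassigned n has value k, every other
    position of value k is n + x for some x \in X, and the test performed by
    [try_assign] at n + x decides G (n + x) = k, because the smaller positions
    of value k have all been handled already. *)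

Lemma mex_notin (s : seq nat) : mex s \notin s.
Proof. by rewrite /mex; case: ex_minnP. Qed.

Lemma ltn_mex (s : seq nat) (j : nat) : j < mex s -> j \in s.
Proof.
rewrite /mex; case: ex_minnP => i _ min_i lt_ji.
by apply: contraLR lt_ji => /min_i; rewrite -leqNgt.
Qed.

Lemma least_unassigned_notin (f : state) : least_unassigned f \notin domf f.
Proof. by rewrite /least_unassigned; case: ex_minnP. Qed.

Lemma ltn_least_unassigned (f : state) (j : nat) :
  j < least_unassigned f -> j \in domf f.
Proof.
rewrite /least_unassigned; case: ex_minnP => i _ min_i lt_ji.
by apply: contraLR lt_ji => /min_i; rewrite -leqNgt.
Qed.

(** For [i < m], the move from [m] to [i] is legal exactly when [m - i] lies outside X, so the
    second clause says that no option of [m] has value [k]; a value above [k] would force such an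
    option by the mex. *)
Lemma nim_allbut_eqP (X : {fset nat}) (k m : nat) :
  nim (allbut X) m = k <->
  k <= nim (allbut X) m /\
  (forall i, i < m -> nim (allbut X) i = k -> m - i \in X).
Proof.
split=> [Gm | [le_k X_k]].
  split=> [|i lt_im Gi]; first by rewrite Gm.
  apply: contraT => notX.
  have := mex_notin [seq nim (allbut X) (m - s) | s <- iota 1 m & allbut X s].
  rewrite -nimE Gm => /mapP[]; exists (m - i); last by rewrite subKn // ltnW.
  by rewrite mem_filter /allbut notX subn_gt0 lt_im mem_iota add1n ltnS leq_subr
             subn_gt0 lt_im.
apply/eqP; rewrite eqn_leq le_k andbT leqNgt; apply/negP.
rewrite nimE => /ltn_mex/mapP[s]; rewrite mem_filter mem_iota add1n ltnS.
case/andP=> /andP[s_gt0 notX] /andP[_ le_sm] /esym Gms.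
have lt_m: m - s < m by rewrite ltn_subrL s_gt0 (leq_trans s_gt0).
by have := X_k _ lt_m Gms; rewrite subKn // (negPf notX).
Qed.

(* In the middle of stage k, s lists the x \in X still to be tried. *)
Definition nim_state (X : {fset nat}) (k n : nat) (s : seq nat) (f : state) :=
  forall m, f.[? m] =
    let g := nim (allbut X) m in
    if (g < k) || (g == k) && (m \notin [seq n + x | x <- s])
    then Some g else None.

(** The test at [n + x] looks only at smaller integers, and since [s] increases from [x] none of
    these is pending, so [f] already shows which of them have value [k]. *)
Lemma nim_state_try_assign (X : {fset nat}) (k n x : nat) (s : seq nat)
    (f : state) :
  path ltn x s -> nim_state X k n (x :: s) f ->
  nim_state X k n s (try_assign X k n f x).
Proof.
move=> /(order_path_min ltn_trans)/allP lt_xs fE.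
have notin_s i : i <= n + x -> i \notin [seq n + y | y <- s].
  move=> le_i; apply/mapP => -[y /lt_xs lt_xy def_i].
  by move: le_i; rewrite def_i leq_add2l leqNgt lt_xy.
have lt_fE i : i < n + x -> (f.[? i] == Some k) = (nim (allbut X) i == k).
  move=> lt_i; rewrite fE /= inE negb_or (notin_s _ (ltnW lt_i)).
  rewrite (ltn_eqF lt_i) andbT.
  case: ltngtP => [lt_k | // | ->] /=; last by rewrite eqxx.
  by rewrite /eq_op /= ltn_eqF.
(* As [n + x] is itself pending, it is assigned only if its value is below [k]. *)
have domE: (n + x \notin domf f) = (k <= nim (allbut X) (n + x)).
  by rewrite -fndSome fE /= inE eqxx andbF orbF [k <= _]leqNgt; case: ifP.
have testE:
    (n + x \notin domf f) &&
    all (fun m => (f.[? m] == Some k) ==> (n + x - m \in X)) (iota 0 (n + x))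
    = (nim (allbut X) (n + x) == k).
  apply/andP/eqP=> [[] | /nim_allbut_eqP[le_k X_k]].
    rewrite domE => le_k /allP X_k; apply/nim_allbut_eqP; split=> // i lt_i Gi.
    have := X_k i; rewrite mem_iota lt_i lt_fE // Gi eqxx /=; exact.
  rewrite domE; split=> //; apply/allP=> i; rewrite mem_iota add0n /= => lt_i.
  by rewrite lt_fE //; apply/implyP => /eqP; apply: X_k.
move=> m; rewrite /try_assign testE /=.
case: (eqVneq m (n + x)) => [-> | ne_m].
  rewrite notin_s // andbT; case: eqP => [Gk | neGk].
    by rewrite fnd_set eqxx orbT Gk.
  by rewrite fE /= inE eqxx andbF.
have ->: (if nim (allbut X) (n + x) == k then f.[n + x <- k] else f).[? m]
         = f.[? m].
  by case: ifP => // _; rewrite fnd_set (negPf ne_m).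
by rewrite fE /= inE (negPf ne_m).
Qed.

Lemma nim_state_foldl (X : {fset nat}) (k n : nat) (s : seq nat) (f : state) :
  sorted ltn s -> nim_state X k n s f ->
  nim_state X k n [::] (foldl (try_assign X k n) f s).
Proof.
elim: s f => //= x s IHs f xs_sorted fE.
by apply: IHs; [exact: path_sorted xs_sorted | exact: nim_state_try_assign].
Qed.

Lemma fnd_state_before (X : {fset nat}) (k m : nat) :
  (forall x : nat, x \in X -> 0 < x) ->
  (state_before X k).[? m] =
  if nim (allbut X) m < k then Some (nim (allbut X) m) else None.
Proof.
move=> X_gt0; elim: k m => [|k IHk] m /=; first by rewrite fnd_fmap0.
rewrite /stage; set f := state_before X k; set n := least_unassigned f.
have domE i : (i \in domf f) = (nim (allbut X) i < k).
  by rewrite -fndSome IHk; case: ifP.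
have lt_n i : i < n -> nim (allbut X) i < k.
  by rewrite -domE; apply: ltn_least_unassigned.
have le_kn: k <= nim (allbut X) n.
  by rewrite leqNgt -domE least_unassigned_notin.
(* No position below [n] has value [k], so the condition on differences is vacuous. *)
have Gn: nim (allbut X) n = k.
  apply/nim_allbut_eqP; split=> // i /lt_n lt_Gi Gi.
  by rewrite Gi ltnn in lt_Gi.
(* Sorting gives a weak order; the absence of repetitions makes it strict. *)
have sorted_X: sorted ltn (sort leq X).
  rewrite ltn_sorted_uniq_leq sort_uniq fset_uniq.
  exact: sort_sorted leq_total _.
suff init: nim_state X k n (sort leq X) f.[n <- k].
  rewrite (nim_state_foldl _ _ _ _ _ sorted_X init) /= andbT.
  by rewrite orbC -leq_eqVlt.
move=> i; rewrite fnd_set IHk /=; case: (eqVneq i n) => [-> | ne_in].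
  (* Positivity of X keeps [n] itself out of the pending list. *)
  rewrite Gn ltnn eqxx /=; case: mapP => // -[x].
  rewrite mem_sort => /X_gt0 x_gt0 /eqP.
  by rewrite -{1}[n]addn0 eqn_add2l ltn_eqF.
(* Any other [i] of value [k] exceeds [n], so [i - n] is in X and [i] is pending. *)
case: ltngtP => //= Gi; case: mapP => // -[].
have lt_ni: n < i.
  rewrite ltn_neqAle eq_sym ne_in leqNgt; apply/negP => /lt_n.
  by rewrite Gi ltnn.
exists (i - n); last by rewrite subnKC // ltnW.
by rewrite mem_sort; have [_] := proj1 (nim_allbut_eqP X k i) Gi; apply.
Qed.

Theorem mainTheorem2 (X : {fset nat}) (hX0 : X != fset0)
    (hXpos : forall x : nat, x \in X -> 0 < x) (k m : nat) :
  m \in assigned_during X k <-> nim (allbut X) m = k.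
Proof.
have fndE j := fnd_state_before X j m hXpos.
rewrite /assigned_during !inE -!fndSome !fndE ltnS.
split=> [|->]; last by rewrite leqnn ltnn /= eqxx.
by case: ltngtP => //= _; rewrite ?andbF.
Qed.
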